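(* Let $H\leq F_m$ be a non-trivial finitely generated subgroup. Then the language $L_H$ is irreducible if and only if $H$ is conjugacy reduced and non cyclic.
   Context: $A=\{a_1,\dots,a_m\}$ is a fixed basis of the free group $F_m$ and $\Sigma=A\cup A^{-1}$. A word over $\Sigma$ is reduced if it has no subword $xx^{-1}$, $x\in\Sigma$. $L_H\subseteq\Sigma^*$ is the set of reduced words (including the empty word) representing elements of $H$. A language $L\subseteq\Sigma^*$ is irreducible if for all $w_1,w_2\in L$ there exists $w\in\Sigma^*$ such that the concatenation $w_1ww_2$ belongs to $L$. $H$ is conjugacy reduced if there is no $a\in\Sigma$ such that every non-empty word of $L_H$ is of the form $a^{-1}wa$; equivalently, there are two non-empty words in $L_H$ with different last letters. *)

(* Defs.v *)
From mathcomp Require Import all_boot.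
From mathcomp Require Import classical_sets.

Set Implicit Arguments.
Unset Strict Implicit.
Unset Printing Implicit Defensive.

Local Open Scope classical_set_scope.
Local Open Scope group_scope.

Definition subgroup (F : groupType) (H : set F) : Prop :=
  [/\ H 1, forall x y, H x -> H y -> H (x * y) & forall x, H x -> H x^-1].

Definition gen_subgroup (F : groupType) (S : set F) : set F :=
  smallest (@subgroup F) S.

Definition finitely_generated (F : groupType) (H : set F) : Prop :=
  exists s : seq F, H = gen_subgroup [set` s].

Definition cyclic_subgroup (F : groupType) (H : set F) : Prop :=
  exists g : F, H = gen_subgroup [set g].

(* The universal property of the free group. Multiplicative maps between
   groups automatically preserve 1 and inverses. *)
Definition free_basis (F : groupType) (m : nat) (a : 'I_m -> F) : Prop :=
  forall (G : groupType) (f : 'I_m -> G),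
    exists2 phi : {multiplicative F -> G},
      forall i, phi (a i) = f i
    & forall psi : {multiplicative F -> G},
        (forall i, psi (a i) = f i) -> psi =1 phi.

(* (i, false) stands for a_i and (i, true) for its inverse; for a free basis
   these 2m elements of the group are pairwise distinct. *)
Notation letter m := ('I_m * bool)%type.

Definition letter_inv (m : nat) (x : letter m) : letter m := (x.1, ~~ x.2).

Definition letter_val (F : groupType) (m : nat) (a : 'I_m -> F)
    (x : letter m) : F :=
  if x.2 then (a x.1)^-1 else a x.1.

Definition word_val (F : groupType) (m : nat) (a : 'I_m -> F)
    (w : seq (letter m)) : F :=
  \prod_(x <- w) letter_val a x.

Definition reduced (m : nat) (w : seq (letter m)) : Prop :=
  forall x : letter m, ~~ infix [:: x; letter_inv x] w.

Definition reduced_language (F : groupType) (m : nat) (a : 'I_m -> F)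
    (H : set F) : set (seq (letter m)) :=
  [set w | reduced w /\ H (word_val a w)].

Definition irreducible_language (T : Type) (L : set (seq T)) : Prop :=
  forall w1 w2, L w1 -> L w2 -> exists w, L (w1 ++ w ++ w2).

Definition conjugacy_reduced (F : groupType) (m : nat) (a : 'I_m -> F)
    (H : set F) : Prop :=
  ~ exists x : letter m, forall w,
      reduced_language a H w -> w <> [::] ->
      exists u, w = letter_inv x :: rcons u x.

(* Main.v *)
(** For reduced [v] and [h], at most [size h] letters of [v] cancel in [v h];
    besides the fact that every element has a unique reduced word, this is all
    that is used about free groups.

    If [L_H] is irreducible and [w u w^-1] is reduced with [u] in [H], then [u]
    does not commute with [w], since [u] and [w u w^-1] would be two reduced
    words of different lengths for one element; so [H] is not cyclic.

    Conversely, [w1] and [w2] can only fail to be joined when [w1] ends with the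
    inverse of the first letter [y] of [w2] and every non-empty word of [L_H]
    begins with [y] or ends with [y^-1]. Let [S] be the set of non-empty words
    of [L_H] not beginning with [y]; it is closed under concatenation. Of two
    words in [S] one is a suffix of the other: otherwise, cancelling the common
    suffix in [u v^-1] leaves a word that neither begins with [y] nor ends with
    [y^-1]. Hence a shortest [v] in [S] generates [S], and it generates [H]
    because [v^n h] reduces to a word of [S] for every [h] in [H] and [n] large. *)
From HB Require Import structures.
Require Import Defs.
From mathcomp Require Import all_boot.
From mathcomp Require Import boolp classical_sets.

Set Implicit Arguments.
Unset Strict Implicit.
Unset Printing Implicit Defensive.

Local Open Scope classical_set_scope.
Local Open Scope group_scope.

(** * Reduced words, formal inverses and cancellation *)

Section Words.
Variable m : nat.
Implicit Types (x y z : letter m) (u v w s p q : seq (letter m)).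

Lemma letter_invK : involutive (@letter_inv m).
Proof. by case=> i b; rewrite /letter_inv /= negbK. Qed.

Lemma letter_inv_neq x : letter_inv x != x.
Proof. by case: x => i b; rewrite xpair_eqE eqxx /=; case: b. Qed.

Definition no_cancel : rel (letter m) := fun x y => y != letter_inv x.
Arguments no_cancel x y /.

Definition reducedb (w : seq (letter m)) : bool := sorted no_cancel w.

Lemma reducedP w : reflect (reduced w) (reducedb w).
Proof.
apply: (iffP idP) => [w_red x | ].
  apply/negP => /infix_sorted/(_ w_red).
  by rewrite /= eqxx.
elim: w => // x [|y w] IH //= red.
apply/andP; split; last first.
  apply: IH => z; apply: contra (red z) => iw.
  exact: infix_trans iw (infix_cons _ _).
apply/negP => /eqP ey; move: (red x); rewrite ey.
by rewrite (prefix_infix [:: x; letter_inv x]).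
Qed.

Definition word_inv (w : seq (letter m)) : seq (letter m) :=
  rev (map (@letter_inv m) w).

Lemma word_invK : involutive word_inv.
Proof.
by move=> w; rewrite /word_inv map_rev revK (mapK letter_invK).
Qed.

Lemma size_word_inv w : size (word_inv w) = size w.
Proof. by rewrite size_rev size_map. Qed.

Lemma word_inv_eq0 w : (word_inv w == [::]) = (w == [::]).
Proof. by rewrite -!size_eq0 size_word_inv. Qed.

Lemma word_inv_cat u v : word_inv (u ++ v) = word_inv v ++ word_inv u.
Proof. by rewrite /word_inv map_cat rev_cat. Qed.

Lemma word_inv_cons x w : word_inv (x :: w) = rcons (word_inv w) (letter_inv x).
Proof. by rewrite /word_inv /= rev_cons. Qed.

Lemma word_inv_rcons x w : word_inv (rcons w x) = letter_inv x :: word_inv w.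
Proof. by rewrite /word_inv map_rcons rev_rcons. Qed.

Lemma reducedb_word_inv w : reducedb (word_inv w) = reducedb w.
Proof.
rewrite /reducedb /word_inv rev_sorted sorted_map.
apply: eq_sorted => x y /=.
by rewrite letter_invK eq_sym.
Qed.

(** For non-empty [u], [ohead (word_inv u)] is the inverse of its last letter, so only the junction
    must be checked. The case of empty [u] stands apart because both heads may then be [None]. *)
Lemma reducedb_cat u v :
  reducedb (u ++ v) = [&& reducedb u, reducedb v &
    (u == [::]) || (ohead v != ohead (word_inv u))].
Proof.
case/lastP: u => [|u x]; first by rewrite andbT.
case: v => [|y v]; first by rewrite cats0 word_inv_rcons /= orbT andbT.
rewrite word_inv_rcons -size_eq0 size_rcons /=.
rewrite /reducedb sorted_cat_cons /=.
rewrite -cats1 cat_rcons sorted_cat_cons /= andbT -andbA.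
by congr andb; rewrite andbC.
Qed.

(** Induction from the right end of [u]: its last letter joins the cancelled part [s] as long as it
    meets its inverse at the head of [v]. *)
Lemma cancellation u v : reducedb u -> reducedb v ->
  exists p s q, [/\ u = p ++ s, v = word_inv s ++ q & reducedb (p ++ q)].
Proof.
elim/last_ind: u v => [|u x IH] v ux_red v_red.
  by exists [::], [::], v.
have /andP[u_red _] : reducedb u && true.
  by move: ux_red; rewrite -cats1 reducedb_cat => /and3P[->].
case: v v_red => [|y v] v_red.
  by exists (rcons u x), [::], [::]; rewrite !cats0.
have [ey|ny] := eqVneq y (letter_inv x); last first.
  exists (rcons u x), [::], (y :: v); rewrite cats0; split => //.
  by rewrite reducedb_cat ux_red v_red word_inv_rcons /= (inj_eq Some_inj) ny orbT.
have [//||p [s [q [eu ev pq]]]] := IH v; first exact: path_sorted v_red.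
exists p, (rcons s x), q; split => //; first by rewrite eu rcons_cat.
by rewrite word_inv_rcons ey ev.
Qed.

End Words.

Arguments no_cancel {m} x y /.

(** * The group of reduced words *)

Section FreeReduction.
Variable m : nat.
Implicit Types (x y : letter m) (u v w : seq (letter m)).

Definition push (x : letter m) (w : seq (letter m)) : seq (letter m) :=
  if w is y :: w' then if y == letter_inv x then w' else x :: w else [:: x].

(** Van der Waerden's trick: words act on reduced words, so associativity needs no confluence
    argument for free reduction. *)
Definition act (u w : seq (letter m)) : seq (letter m) := foldr push w u.

Lemma push_reduced x w : reducedb w -> reducedb (push x w).
Proof.
case: w => //= y w w_red; have [_|ny] := eqVneq; last by rewrite /reducedb /= ny.
exact: path_sorted w_red.
Qed.

Lemma push_cons x w : reducedb (x :: w) -> push x w = x :: w.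
Proof. by case: w => //= y w /andP[/negPf ->]. Qed.

Lemma pushK x w : reducedb w -> push (letter_inv x) (push x w) = w.
Proof.
case: w => [|y w] /=; first by rewrite letter_invK eqxx.
have [-> w_red|_ _ /=] := eqVneq; last by rewrite letter_invK eqxx.
exact: push_cons.
Qed.

Lemma act_reduced u w : reducedb w -> reducedb (act u w).
Proof. by move=> w_red; elim: u => //= x u; apply: push_reduced. Qed.

Lemma act_nil u : reducedb u -> act u [::] = u.
Proof.
elim: u => //= x u IH xu_red; rewrite IH ?push_cons //.
exact: path_sorted xu_red.
Qed.

(** A cancellation inside [push x u] is matched by [pushK] on the reduced word [act u w]. *)
Lemma act_push x u w : reducedb w -> act (push x u) w = push x (act u w).
Proof.
case: u => //= y u w_red; have [->|//] := eqVneq.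
by have := pushK (letter_inv x) (act_reduced u w_red); rewrite letter_invK => ->.
Qed.

Lemma actA u v w : reducedb w -> act (act u v) w = act u (act v w).
Proof. by move=> w_red; elim: u => //= x u IH; rewrite act_push // IH. Qed.

Lemma act_word_inv u w : reducedb w -> act (word_inv u) (act u w) = w.
Proof.
elim: u => //= x u IH w_red.
by rewrite word_inv_cons /act foldr_rcons -/(act _ _) pushK ?act_reduced // IH.
Qed.

Definition reduced_word := {w : seq (letter m) | reducedb w}.

HB.instance Definition _ := Choice.on reduced_word.

Definition reduced_word1 : reduced_word := exist _ [::] isT.

Definition reduced_wordM (u v : reduced_word) : reduced_word :=
  exist _ (act (val u) (val v)) (act_reduced (val u) (valP v)).

Definition reduced_wordV (u : reduced_word) : reduced_word :=
  exist _ (word_inv (val u)) (etrans (reducedb_word_inv (val u)) (valP u)).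

Lemma reduced_wordMA : associative reduced_wordM.
Proof. by move=> u v w; apply: val_inj; rewrite /= actA ?(valP w). Qed.

Lemma reduced_word1M : left_id reduced_word1 reduced_wordM.
Proof. by move=> u; apply: val_inj. Qed.

Lemma reduced_wordM1 : right_id reduced_word1 reduced_wordM.
Proof. by move=> u; apply: val_inj; rewrite /= act_nil ?(valP u). Qed.

Lemma reduced_wordVM : left_inverse reduced_word1 reduced_wordV reduced_wordM.
Proof.
move=> u; apply: val_inj => /=.
by rewrite -[X in act _ X](act_nil (valP u)) act_word_inv.
Qed.

Lemma reduced_wordMV : right_inverse reduced_word1 reduced_wordV reduced_wordM.
Proof.
move=> u; apply: val_inj => /=.
have u'_red : reducedb (word_inv (val u)) by rewrite reducedb_word_inv (valP u).
by rewrite -[X in act _ X](act_nil u'_red) -[X in act X _]word_invK act_word_inv.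
Qed.

HB.instance Definition _ := isGroup.Build reduced_word reduced_wordMA
  reduced_word1M reduced_wordM1 reduced_wordVM reduced_wordMV.

End FreeReduction.

(** * Evaluation of words as a morphism *)

Section WordVal.
Variables (m : nat) (F : groupType) (a : 'I_m -> F).
Implicit Types (x : letter m) (u v w : seq (letter m)).

Lemma word_val_nil : word_val a [::] = 1.
Proof. by rewrite /word_val big_nil. Qed.

Lemma word_val_cons x w : word_val a (x :: w) = letter_val a x * word_val a w.
Proof. by rewrite /word_val big_cons. Qed.

Lemma word_val_cat u v : word_val a (u ++ v) = word_val a u * word_val a v.
Proof. by rewrite /word_val big_cat. Qed.

Lemma letter_val_inv x : letter_val a (letter_inv x) = (letter_val a x)^-1.
Proof. by case: x => i [] //=; rewrite /letter_val /= invgK. Qed.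

Lemma word_val_inv w : word_val a (word_inv w) = (word_val a w)^-1.
Proof.
elim: w => [|x w IH]; first by rewrite word_val_nil invg1.
rewrite word_inv_cons -cats1 word_val_cat IH !word_val_cons word_val_nil.
by rewrite mulg1 letter_val_inv invgM.
Qed.

Lemma word_val_push x w : word_val a (push x w) = letter_val a x * word_val a w.
Proof.
case: w => [|y w]; first by rewrite word_val_cons.
rewrite /=; have [->|_] := eqVneq; last by rewrite word_val_cons.
by rewrite word_val_cons letter_val_inv mulVKg.
Qed.

Lemma word_val_act u w : word_val a (act u w) = word_val a u * word_val a w.
Proof.
elim: u => [|x u IH] /=; first by rewrite word_val_nil mul1g.
by rewrite word_val_push IH word_val_cons mulgA.
Qed.

Definition reduced_word_val (w : reduced_word m) : F := word_val a (val w).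

Lemma reduced_word_valM : {morph reduced_word_val : u v / u * v}.
Proof. by move=> u v; apply: word_val_act. Qed.

HB.instance Definition _ :=
  isMultiplicative.Build (reduced_word m) F reduced_word_val reduced_word_valM.

End WordVal.

Lemma multiplicative1 (G K : groupType) (f : {multiplicative G -> K}) : f 1 = 1.
Proof. by apply: (mulgI (f 1)); rewrite -gmulfM !mulg1. Qed.

Lemma multiplicativeV (G K : groupType) (f : {multiplicative G -> K}) :
  {morph f : x / x^-1}.
Proof. by move=> x; apply: (mulgI (f x)); rewrite -gmulfM !mulgV multiplicative1. Qed.

(** * Existence and uniqueness of reduced words *)

Section FreeBasis.
Variables (m : nat) (F : groupType) (a : 'I_m -> F).
Hypothesis a_basis : free_basis a.

Definition reduced_letter (i : 'I_m) : reduced_word m :=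
  exist _ [:: (i, false)] isT.

(** The morphism [phi] to the group of reduced words, given by the universal property, recovers a
    reduced word from its value. *)
Lemma word_val_inj u v :
  reducedb u -> reducedb v -> word_val a u = word_val a v -> u = v.
Proof.
have [phi phi_a _] := a_basis reduced_letter.
suff phiK w : reducedb w -> val (phi (word_val a w)) = w.
  by move=> u_red v_red e; rewrite -[u]phiK // e phiK.
elim: w => [|x w IH] w_red; first by rewrite word_val_nil multiplicative1.
rewrite word_val_cons gmulfM /= IH; last exact: path_sorted w_red.
suff -> : val (phi (letter_val a x)) = [:: x] by exact: push_cons.
by case: x {w_red} => i []; rewrite /letter_val /= ?multiplicativeV phi_a.
Qed.

(** Evaluation after [phi] and the identity agree on the basis, hence everywhere by uniqueness. *)
Lemma word_val_surj g : exists2 w, reducedb w & word_val a w = g.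
Proof.
have [phi phi_a _] := a_basis reduced_letter.
have [id_a _ id_uniq] := a_basis a.
exists (val (phi g)); first exact: valP.
have e1 : (reduced_word_val a \o phi) g = id_a g.
  apply: id_uniq => i /=.
  by rewrite phi_a /reduced_word_val word_val_cons word_val_nil mulg1.
have e2 : idfun g = id_a g by apply: id_uniq.
by rewrite [RHS]e2 -e1.
Qed.

End FreeBasis.

(** * Generated subgroups *)

Section Subgroups.
Variable F : groupType.
Implicit Types (S H : set F) (g : F).

Lemma sub_gen_subgroup S : S `<=` gen_subgroup S.
Proof. exact: sub_gen_smallest. Qed.

Lemma gen_subgroup_min S H : subgroup H -> S `<=` H -> gen_subgroup S `<=` H.
Proof. exact: smallest_sub. Qed.

Lemma gen_subgroupP S : subgroup (gen_subgroup S).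
Proof.
split=> [M [[M1 _ _] _]//|x y Hx Hy M MS|x Hx M MS].
  by have [[_ MM _] _] := MS; exact: MM (Hx _ MS) (Hy _ MS).
by have [[_ _ MV] _] := MS; exact: MV (Hx _ MS).
Qed.

(** The centralizer of [g] is a subgroup containing [g]. *)
Lemma gen_subgroup_commute g h : gen_subgroup [set g] h -> commute g h.
Proof.
apply: (gen_subgroup_min (H := commute g)) => [|_ ->]; last exact: commute_refl.
by split; [exact: commute1|move=> x y; exact: commuteM|move=> x; exact: commuteV].
Qed.

Lemma gen_subgroup1 : gen_subgroup [set 1] = [set 1 : F].
Proof.
apply: smallest_id; split=> [//|x y -> ->|x ->]; first by rewrite /= mulg1.
by rewrite /= invg1.
Qed.

End Subgroups.

(** * Closure properties of the language of a subgroup *)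

Section Language.
Variables (m : nat) (F : groupType) (a : 'I_m -> F) (H : set F).
Hypothesis H_subgroup : subgroup H.
Let L := reduced_language a H.
Implicit Types (u v w : seq (letter m)) (y : letter m).

Lemma languageP w : L w <-> reducedb w /\ H (word_val a w).
Proof. by split=> -[/reducedP wr Hw]; split=> //; apply/reducedP. Qed.

Lemma language_inv w : L w -> L (word_inv w).
Proof.
have [_ _ HV] := H_subgroup.
move=> /languageP[wr Hw]; apply/languageP.
by rewrite reducedb_word_inv word_val_inv; split; last apply: HV.
Qed.

(** Factors of a reduced word are reduced, and the outer values can be divided out in [H]. *)
Lemma language_middle w1 w w2 : L w1 -> L w2 -> L (w1 ++ w ++ w2) -> L w.
Proof.
have [_ HM HV] := H_subgroup.
move=> /languageP[_ H1] /languageP[_ H2] /languageP[].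
rewrite !reducedb_cat !word_val_cat => /and3P[_ /and3P[wr _ _] _] H12.
apply/languageP; split=> //.
rewrite -(mulgK (word_val a w2) (word_val a w)) -(mulKg (word_val a w1) (_ * _)).
rewrite !mulgA -(mulgA (_^-1)) -(mulgA (_^-1)).
by apply: (HM); [apply: HM; [exact: HV|rewrite -mulgA]|exact: HV].
Qed.

Lemma language_word g : free_basis a -> H g -> exists2 w, L w & word_val a w = g.
Proof.
move=> a_basis Hg; have [w wr wg] := word_val_surj a_basis g.
by exists w => //; apply/languageP; rewrite wg.
Qed.

Lemma nontrivial_language :
  free_basis a -> H <> [set 1] -> exists2 w, L w & w != [::].
Proof.
move=> a_basis Hnt; apply: contrapT => noL; apply: Hnt.
apply/seteqP; split=> [g Hg|_ ->]; last by case: H_subgroup.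
have [w Lw <-] := language_word a_basis Hg.
case: (eqVneq w [::]) => [->|w_neq]; first exact: word_val_nil.
by case: noL; exists w.
Qed.

(** * Words of the language not beginning with a given letter *)

Section Stems.
Variable y : letter m.

Definition stem (w : seq (letter m)) : Prop :=
  [/\ L w, w != [::] & ohead w != Some y].

Hypothesis covered : forall w, L w -> w != [::] ->
  ohead w = Some y \/ ohead (word_inv w) = Some y.

Lemma stem_last w : stem w -> ohead (word_inv w) = Some y.
Proof.
by case=> Lw w_neq w_y; case: (covered Lw w_neq) => // e; rewrite e eqxx in w_y.
Qed.

(** Nothing cancels at the junction: [u] ends with the inverse of [y], and [v] does not begin with
    [y]. *)
Lemma stem_cat u v : stem u -> stem v -> stem (u ++ v).
Proof.
have [_ HM _] := H_subgroup.
move=> Su Sv; have uy := stem_last Su.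
case: Su Sv => /languageP[ur Hu] u_neq u_y [/languageP[vr Hv] v_neq v_y].
split.
- apply/languageP; rewrite reducedb_cat ur vr uy v_y orbT word_val_cat.
  by split; last exact: HM.
- by case: (u) u_neq.
- by case: (u) u_neq u_y.
Qed.

(** After cancellation in [u] times the inverse of [v], an empty [q] gives the conclusion, and an
    empty [p] with non-empty [q] would make [v] longer than [u]. If neither is empty, [p ++ q]
    begins like [u] and its inverse begins like [v], against [covered]. *)
Lemma stem_suffix u v : stem u -> stem v -> (size v <= size u)%N ->
  u = v \/ exists2 p, stem p & u = p ++ v.
Proof.
have [_ HM HV] := H_subgroup.
move=> [Lu u_neq u_y] [Lv v_neq v_y] le_vu.
have /languageP[ur Hu] := Lu; have /languageP[vr Hv] := language_inv Lv.
have [p [s [q [eu ev pq_red]]]] := cancellation ur vr.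
have ev' : v = word_inv q ++ s by rewrite -[v]word_invK ev word_inv_cat word_invK.
have Lpq : L (p ++ q).
  apply/languageP; split=> //.
  have -> : word_val a (p ++ q) = word_val a u * word_val a (word_inv v).
    by rewrite ev eu !word_val_cat word_val_inv -!mulgA mulVKg.
  exact: HM.
have [q0|q_neq] := eqVneq q [::].
  rewrite q0 in ev' Lpq; rewrite cats0 in Lpq; rewrite ev' /=.
  have [p0|p_neq] := eqVneq p [::]; [left|right; exists p => //].
    by rewrite eu p0.
  by split=> //; move: u_y; rewrite eu; case: (p) p_neq.
have [p0|p_neq] := eqVneq p [::].
  move: le_vu; rewrite ev' eu p0 size_cat size_word_inv /= -{2}[size s]add0n.
  by rewrite leq_add2r leqn0 size_eq0 (negPf q_neq).
have [] := covered Lpq; first by case: (p) p_neq.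
- by move: u_y; rewrite eu; case: (p) p_neq => //= z p' _ /eqP.
- move: v_y; rewrite ev' word_inv_cat; case: (word_inv q) (word_inv_eq0 q) => //=.
    by rewrite (negPf q_neq).
  by move=> z q' _ /eqP.
Qed.

Lemma shortest_stem w : stem w ->
  exists2 v, stem v & forall u, stem u -> (size v <= size u)%N.
Proof.
have [n] := ubnP (size w); elim: n w => // n IH w /ltnSE le_wn Sw.
have [min_w|] := pselect (forall u, stem u -> (size w <= size u)%N).
  by exists w.
move=> /existsNP[u /not_implyP[Su /negP]]; rewrite -ltnNge => lt_uw.
exact: IH (leq_trans lt_uw le_wn) Su.
Qed.

(** Copies of [v] are split off the right end; what remains is a strictly shorter stem. *)
Lemma stem_power v : stem v -> (forall u, stem u -> (size v <= size u)%N) ->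
  forall u, stem u -> gen_subgroup [set word_val a v] (word_val a u).
Proof.
have [_ GM _] := gen_subgroupP [set word_val a v].
have Gv : gen_subgroup [set word_val a v] (word_val a v).
  exact: sub_gen_subgroup.
move=> Sv min_v u.
have [n] := ubnP (size u); elim: n u => // n IH u /ltnSE le_un Su.
have [->//|[p Sp eu]] := stem_suffix Su Sv (min_v u Su).
rewrite eu word_val_cat; apply: GM => //; apply: IH => //.
apply: leq_trans le_un; rewrite eu size_cat -[ltnLHS]addn0 ltn_add2l.
by case: Sv => _; case: (v).
Qed.

Lemma stem_cyclic w : free_basis a -> stem w -> cyclic_subgroup H.
Proof.
move=> a_basis /shortest_stem[v Sv min_v]; exists (word_val a v).
have [_ HM HV] := H_subgroup.
have [_ GM GV] := gen_subgroupP [set word_val a v].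
apply/seteqP; split; last first.
  by apply: gen_subgroup_min => // _ ->; case: Sv => /languageP[].
move=> g Hg; have [h /languageP[hr Hh] <-] := language_word a_basis Hg.
(* With [(size h).+1] copies of the non-empty [v], [V] is longer than [h], so its first letter
   survives in the reduced form of [V ++ h]. *)
pose V := flatten (nseq (size h).+1 v).
have SV : stem V.
  rewrite /V; elim: (size h) => [|n IH]; first by rewrite /= cats0.
  exact: stem_cat.
have ltV : (size h < size V)%N.
  have : (0 < size v)%N by case: Sv => _; case: (v).
  rewrite /V size_flatten /shape map_nseq sumn_nseq.
  by case: (size v) => // k _; rewrite mulSn ltn_addr.
have [LV V_neq V_y] := SV; have /languageP[Vr HV'] := LV.
have [p [s [q [eV eh pq_red]]]] := cancellation Vr hr.
have p_neq : p != [::].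
  apply: contraTneq ltV => p0.
  by rewrite -leqNgt eV p0 eh /= size_cat size_word_inv leq_addr.
have epq : word_val a (p ++ q) = word_val a V * word_val a h.
  by rewrite eV eh !word_val_cat word_val_inv -!mulgA mulVKg.
have Spq : stem (p ++ q).
  split; first by apply/languageP; rewrite epq; split; last exact: HM.
  - by case: (p) p_neq.
  - by move: V_y; rewrite eV; case: (p) p_neq.
rewrite -[word_val a h](mulKg (word_val a V)) -epq.
by apply: GM; [apply: GV|]; apply: stem_power.
Qed.

End Stems.

End Language.

Theorem proposition5p17 (m : nat) (F : groupType) (a : 'I_m -> F)
    (a_basis : free_basis a) (H : set F) (H_subgroup : subgroup H)
    (H_fg : finitely_generated H) (H_nontrivial : H <> [set 1]) :
  irreducible_language (reduced_language a H) <->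
  (conjugacy_reduced a H /\ ~ cyclic_subgroup H).
Proof.
split=> [irr|[conj_red not_cyclic] w1 w2 L1 L2].
- have [w Lw w_neq] := nontrivial_language H_subgroup a_basis H_nontrivial.
  split.
  + move=> [x all_x].
    have [u Luu] := irr _ _ Lw Lw.
    have Lu := language_middle H_subgroup Lw Lw Luu.
    have [w' ew] := all_x _ Lw (elimN eqP w_neq).
    (* Since [w] ends with [x], this head makes [w ++ u ++ w] non-reduced. *)
    have uw_x : ohead (u ++ w) = Some (letter_inv x).
      have [->|/eqP u_neq] := eqVneq u [::]; first by rewrite ew.
      by have [u' ->] := all_x _ Lu u_neq.
    have /languageP[] := Luu; rewrite reducedb_cat uw_x (negPf w_neq) => /and3P[_ _].
    by rewrite ew word_inv_cons word_inv_rcons eqxx.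
  + move=> [g eH].
    have Hg : H g by rewrite eH; exact: sub_gen_subgroup.
    have [v Lv ev] := language_word a_basis Hg.
    have v_neq : v != [::].
      apply/eqP => v0; apply: H_nontrivial.
      by rewrite eH -ev v0 word_val_nil gen_subgroup1.
    have Lv' := language_inv H_subgroup Lv.
    have [u Lvuv] := irr _ _ Lv Lv'.
    have /languageP[ur] := language_middle H_subgroup Lv Lv' Lvuv.
    rewrite eH => /gen_subgroup_commute gu.
    have /languageP[vuvr _] := Lvuv.
    have /(congr1 size)/eqP : v ++ u ++ word_inv v = u.
      apply: (word_val_inj a_basis) => //.
      by rewrite !word_val_cat word_val_inv ev mulgA gu mulgK.
    rewrite !size_cat addnCA -[eqbRHS]addn0 eqn_add2l addn_eq0 size_eq0.
    by rewrite (negPf v_neq).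
- apply: contrapT => no_join.
  have [w1_0|w1_neq] := eqVneq w1 [::].
    by apply: no_join; exists [::]; rewrite w1_0.
  have /languageP[r1 H1] := L1; have /languageP[r2 H2] := L2.
  have [_ HM _] := H_subgroup.
  (* Membership in [H] is automatic, so only cancellation can prevent joining. *)
  have join u : reduced_language a H u -> reducedb (w1 ++ u ++ w2) -> False.
    move=> /languageP[ur Hu] red; apply: no_join; exists u; apply/languageP.
    by rewrite !word_val_cat; split=> //; apply: (HM) => //; apply: HM.
  case e2: w2 => [|y w2'].
    by apply: no_join; exists [::]; rewrite e2 !cats0.
  have e1 : ohead (word_inv w1) = Some y.
    apply/eqP/negPn/negP => ne; apply: no_join; exists [::].
    apply/languageP; rewrite reducedb_cat r1 r2 word_val_cat e2.
    rewrite (negPf w1_neq) /= eq_sym ne.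
    by split=> //; rewrite -e2; apply: HM.
  (* Any exception [u] would itself join [w1] to [w2]. *)
  have covered u : reduced_language a H u -> u != [::] ->
      ohead u = Some y \/ ohead (word_inv u) = Some y.
    move=> Lu u_neq; have /languageP[ur _] := Lu.
    apply: contrapT => /not_orP[/eqP u_y /eqP u'_y]; apply: (join u Lu).
    rewrite !reducedb_cat r1 ur r2 e1 e2 /= (negPf u_neq) (negPf w1_neq) /=.
    by rewrite eq_sym u'_y; case: (u) u_neq u_y.
  (* As [H] is not cyclic there are no stems; applied to [w] and to its inverse, this forces [w] to
     begin with [y] and end with [letter_inv y]. *)
  apply: conj_red; exists (letter_inv y) => w Lw /eqP w_neq.
  have no_stem u : stem a H y u -> False.
    by move=> Su; apply/not_cyclic/(stem_cyclic H_subgroup covered a_basis Su).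
  have w_y : ohead w = Some y.
    by apply/eqP/negPn/negP => ne; apply: (no_stem w).
  have w'_y : ohead (word_inv w) = Some y.
    apply/eqP/negPn/negP => ne; apply: (no_stem (word_inv w)); split => //.
      exact: language_inv.
    by rewrite word_inv_eq0.
  rewrite letter_invK.
  case: w w_y w'_y {Lw w_neq} => //= _ w [->].
  (* The two end letters are distinct positions: a one-letter word would give [letter_inv y = y]. *)
  case/lastP: w => [|u x]; last first.
    by rewrite -rcons_cons word_inv_rcons /= => -[<-]; exists u; rewrite letter_invK.
  by move=> [/eqP]; rewrite (negPf (letter_inv_neq y)).
Qed.
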